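(* An MV-algebra $A$ is the MV-algebra reduct of some $\delta$-algebra if and only if the map $\eta_A\colon A\to\mathrm{C}(\mathrm{Max}\,A)$, $a\mapsto\widehat a$, is an isomorphism of MV-algebras.
   Context: An MV-algebra is a structure $(A,\oplus,\neg,0)$ such that $(A,\oplus,0)$ is a commutative monoid, $\neg\neg x=x$, $x\oplus\neg 0=\neg 0$, and $\neg(\neg x\oplus y)\oplus y=\neg(\neg y\oplus x)\oplus x$. Write $1:=\neg 0$, $x\odot y:=\neg(\neg x\oplus\neg y)$, $x\ominus y:=x\odot\neg y$, $d(x,y):=(x\ominus y)\oplus(y\ominus x)$; $x\le y$ iff $x\ominus y=0$ is a lattice order. $[0,1]$ is an MV-algebra with $x\oplus y=\min\{x+y,1\}$, $\neg x=1-x$. An ideal of $A$ is a downward closed subset containing $0$ and closed under $\oplus$; $\mathrm{Max}\,A$ is the set of maximal proper ideals, with the topology whose closed sets are $\{\mathfrak m\in\mathrm{Max}\,A: I\subseteq\mathfrak m\}$ for ideals $I$ (a compact Hausdorff space). For each $\mathfrak m\in\mathrm{Max}\,A$ there is exactly one MV-homomorphism $\mathfrak h_{\mathfrak m}\colon A/\mathfrak m\to[0,1]$, and $\widehat a(\mathfrak m):=\mathfrak h_{\mathfrak m}(a/\mathfrak m)$. For a compact Hausdorff space $X$, $\mathrm{C}(X)$ is the MV-algebra of continuous functions $X\to[0,1]$ with pointwise operations. A $\delta$-algebra is a structure $(A,\delta,\oplus,\neg,0)$ where $(A,\oplus,\neg,0)$ is an MV-algebra and $\delta$ is an operation of countably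 infinite arity such that, writing $\vec x=(x_1,x_2,\ldots)$, $\vec 0=(0,0,\ldots)$ and $f_{1/2}(x):=\delta(x,\vec 0)$: (A1) $d(\delta(\vec x),\delta(x_1,\vec 0))=\delta(0,x_2,x_3,\ldots)$; (A2) $f_{1/2}(\delta(\vec x))=\delta(f_{1/2}(x_1),f_{1/2}(x_2),\ldots)$; (A3) $\delta(x,x,\ldots)=x$; (A4) $\delta(0,\vec x)=f_{1/2}(\delta(\vec x))$; (A5) $\delta(x_1\oplus y_1,x_2\oplus y_2,\ldots)\ge\delta(x_1,x_2,\ldots)$; (A6) $f_{1/2}(x\ominus y)=f_{1/2}(x)\ominus f_{1/2}(y)$. *)

(* Defs.v *)
From HB Require Import structures.
From mathcomp Require Import all_boot all_order all_algebra.
From mathcomp Require Import all_classical all_reals all_analysis.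
From mathcomp Require Import lra.
Set Implicit Arguments.
Unset Strict Implicit.
Unset Printing Implicit Defensive.
Import Order.TTheory GRing.Theory Num.Theory.
Import numFieldNormedType.Exports.

Declare Scope mv_scope.
Delimit Scope mv_scope with MV.
Local Open Scope mv_scope.
Local Open Scope classical_set_scope.
Local Open Scope quotient_scope.

HB.mixin Record isMVAlgebra A := {
  mv0 : A;
  mvneg : A -> A;
  mvplus : A -> A -> A;
  mvplusA : associative mvplus;
  mvplusC : commutative mvplus;
  mvplus0 : right_id mv0 mvplus;
  mvnegK : involutive mvneg;
  mvplus1 : forall x, mvplus x (mvneg mv0) = mvneg mv0;
  mvluk : forall x y, mvplus (mvneg (mvplus (mvneg x) y)) y =
                      mvplus (mvneg (mvplus (mvneg y) x)) x
}.

#[short(type="mvAlgType")]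
HB.structure Definition MVAlgebra := {A of Choice A & isMVAlgebra A}.

Notation "¬ x" := (mvneg x) (at level 35, right associativity) : mv_scope.
Notation "x ⊕ y" := (mvplus x y) (at level 50, left associativity) : mv_scope.

Section MVOperations.
Variable A : mvAlgType.
Implicit Types x y : A.

Definition mv1 : A := ¬ mv0.
Definition mvodot x y : A := ¬ (¬ x ⊕ ¬ y).
Definition mvminus x y : A := mvodot x (¬ y).
Definition mvdist x y : A := mvminus x y ⊕ mvminus y x.
Definition mvle x y : Prop := mvminus x y = mv0.

End MVOperations.

Notation "x ⊙ y" := (mvodot x y) (at level 40, left associativity) : mv_scope.
Notation "x ⊖ y" := (mvminus x y) (at level 50, left associativity) : mv_scope.
Notation "x ≼ y" := (mvle x y) (at level 70, no associativity) : mv_scope.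

(* Sequences are indexed from 0, so that x_1, x_2, ... is x 0, x 1, ... *)
Definition scons (T : Type) (x : T) (s : nat -> T) : nat -> T :=
  fun n => if n is k.+1 then s k else x.

Definition half_of (A : mvAlgType) (delta : (nat -> A) -> A) (x : A) : A :=
  delta (scons x (fun=> mv0)).

HB.mixin Record MVAlgebra_isDelta A of MVAlgebra A := {
  delta : (nat -> A) -> A;
  deltaA1 : forall x : nat -> A,
    mvdist (delta x) (delta (scons (x 0%N) (fun=> mv0))) =
    delta (scons mv0 (fun n => x n.+1));
  deltaA2 : forall x : nat -> A,
    half_of delta (delta x) = delta (fun n => half_of delta (x n));
  deltaA3 : forall x : A, delta (fun=> x) = x;
  deltaA4 : forall x : nat -> A,
    delta (scons mv0 x) = half_of delta (delta x);
  deltaA5 : forall x y : nat -> A, delta x ≼ delta (fun n => x n ⊕ y n);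
  deltaA6 : forall x y : A,
    half_of delta (x ⊖ y) = half_of delta x ⊖ half_of delta y
}.

#[short(type="deltaAlgType")]
HB.structure Definition DeltaAlgebra :=
  {A of MVAlgebra A & MVAlgebra_isDelta A}.

Definition mv_hom (A B : mvAlgType) (f : A -> B) : Prop :=
  [/\ f mv0 = mv0, {morph f : x / ¬ x} & {morph f : x y / x ⊕ y}].

Definition mv_iso (A B : mvAlgType) (f : A -> B) : Prop :=
  mv_hom f /\ bijective f.

Section MVTheory.
Variable A : mvAlgType.
Implicit Types x y z t : A.

Lemma mvplus0l x : mv0 ⊕ x = x.
Proof. by rewrite mvplusC mvplus0. Qed.

Lemma mvplus1l x : mv1 A ⊕ x = mv1 A.
Proof. by rewrite mvplusC mvplus1. Qed.

Lemma mvneg1 : ¬ mv1 A = mv0.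
Proof. exact: mvnegK. Qed.

Lemma mvplusN x : ¬ x ⊕ x = mv1 A.
Proof.
have := mvluk x (¬ mv0).
by rewrite !mvplus1 mvnegK mvplus0l => <-.
Qed.

Lemma mvminusE x y : x ⊖ y = ¬ (¬ x ⊕ y).
Proof. by rewrite /mvminus /mvodot mvnegK. Qed.

Lemma mvleE x y : x ≼ y <-> ¬ x ⊕ y = mv1 A.
Proof.
rewrite /mvle mvminusE; split=> [xy|->]; last exact: mvneg1.
by rewrite -[LHS]mvnegK xy.
Qed.

Lemma mvleP x y : x ≼ y <-> exists c, y = x ⊕ c.
Proof.
rewrite mvleE; split=> [xy|[c ->]]; last by rewrite mvplusA mvplusN mvplus1l.
exists (¬ (¬ y ⊕ x)); rewrite [RHS]mvplusC.
by rewrite -mvluk xy mvneg1 mvplus0l.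
Qed.

Lemma mvle_refl x : x ≼ x.
Proof. by apply/mvleE/mvplusN. Qed.

Lemma mvle_trans y x z : x ≼ y -> y ≼ z -> x ≼ z.
Proof.
move=> /mvleP[c ->] /mvleP[d ->]; apply/mvleP.
by exists (c ⊕ d); rewrite mvplusA.
Qed.

Lemma mvle_plus x y z t : x ≼ y -> z ≼ t -> x ⊕ z ≼ y ⊕ t.
Proof.
move=> /mvleP[c ->] /mvleP[d ->]; apply/mvleP; exists (c ⊕ d).
by rewrite -!mvplusA; congr mvplus; rewrite !mvplusA [c ⊕ z]mvplusC.
Qed.

Lemma mvle_plusr x y : x ≼ x ⊕ y.
Proof. by apply/mvleP; exists y. Qed.

Lemma mvle1 x : x ≼ mv1 A.
Proof. by apply/mvleE/mvplus1. Qed.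

Lemma mv0_le x : mv0 ≼ x.
Proof. by apply/mvleP; exists x; rewrite mvplus0l. Qed.

Lemma mvle_minus x y z : x ⊖ y ≼ z <-> x ≼ y ⊕ z.
Proof. by rewrite !mvleE mvminusE mvnegK mvplusA. Qed.

Lemma mvminusK x y : x ≼ y ⊕ (x ⊖ y).
Proof. by apply/mvle_minus/mvle_refl. Qed.

Lemma mvminus_trans y x z : x ⊖ z ≼ (x ⊖ y) ⊕ (y ⊖ z).
Proof.
apply/mvle_minus; apply: (mvle_trans (mvminusK x y)).
rewrite [_ ⊕ (y ⊖ z)]mvplusC mvplusA.
by apply: mvle_plus; [exact: mvminusK|exact: mvle_refl].
Qed.

Lemma mvminus_plus x y z t : (x ⊕ y) ⊖ (z ⊕ t) ≼ (x ⊖ z) ⊕ (y ⊖ t).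
Proof.
apply/mvle_minus.
have -> : z ⊕ t ⊕ ((x ⊖ z) ⊕ (y ⊖ t)) = (z ⊕ (x ⊖ z)) ⊕ (t ⊕ (y ⊖ t)).
  by rewrite -!mvplusA; congr mvplus; rewrite !mvplusA [t ⊕ (x ⊖ z)]mvplusC.
by apply: mvle_plus; exact: mvminusK.
Qed.

Lemma mvminusN x y : ¬ x ⊖ ¬ y = y ⊖ x.
Proof. by rewrite !mvminusE mvnegK mvplusC. Qed.

Lemma mvminusxx x : x ⊖ x = mv0.
Proof. exact: mvle_refl. Qed.

Lemma mvdistxx x : mvdist x x = mv0.
Proof. by rewrite /mvdist mvminusxx mvplus0. Qed.

Lemma mvdistC x y : mvdist x y = mvdist y x.
Proof. exact: mvplusC. Qed.

End MVTheory.

Definition is_ideal (A : mvAlgType) (I : set A) : Prop :=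
  [/\ I mv0, forall x y, x ≼ y -> I y -> I x &
      forall x y, I x -> I y -> I (x ⊕ y)].

Identity Coercion set_to_fun : set >-> Funclass.

Record ideal (A : mvAlgType) := Ideal {
  ideal_set :> set A;
  idealP : is_ideal ideal_set
}.

Definition proper_ideal (A : mvAlgType) (I : ideal A) : Prop :=
  (I : set A) != setT.

Definition maximal_ideal (A : mvAlgType) (m : ideal A) : Prop :=
  proper_ideal m /\
  forall J : ideal A, proper_ideal J -> m `<=` J -> (m : set A) = J.

Section Quotient.
Variables (A : mvAlgType) (I : ideal A).
Implicit Types x y z t : A.

Let ideal0 : I mv0. Proof. by have [] := idealP I. Qed.
Let idealS x y : x ≼ y -> I y -> I x. Proof. by have [_ + _] := idealP I; apply. Qed.
Let idealD x y : I x -> I y -> I (x ⊕ y).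
Proof. by have [_ _ +] := idealP I; apply. Qed.

Lemma ideal_dist x y : I (mvdist x y) <-> I (x ⊖ y) /\ I (y ⊖ x).
Proof.
split=> [xy|[]]; last exact: idealD.
split; apply: idealS xy; first exact: mvle_plusr.
by rewrite mvdistC; exact: mvle_plusr.
Qed.

Definition ideal_equiv x y : bool := `[< I (mvdist x y) >].

Lemma ideal_equiv_refl : reflexive ideal_equiv.
Proof. by move=> x; apply/asboolP; rewrite mvdistxx. Qed.

Lemma ideal_equiv_sym : symmetric ideal_equiv.
Proof. by move=> x y; rewrite /ideal_equiv mvdistC. Qed.

Lemma ideal_equiv_trans : transitive ideal_equiv.
Proof.
move=> y x z /asboolP/ideal_dist[xy yx] /asboolP/ideal_dist[yz zy].
apply/asboolP/ideal_dist; split.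
  by apply: idealS (mvminus_trans y x z) _; exact: idealD.
by apply: idealS (mvminus_trans y z x) _; exact: idealD.
Qed.

Canonical ideal_equiv_rel : equiv_rel A :=
  EquivRel ideal_equiv ideal_equiv_refl ideal_equiv_sym ideal_equiv_trans.

Definition mv_quotient := {eq_quot ideal_equiv_rel}.

HB.instance Definition _ := Choice.on mv_quotient.
HB.instance Definition _ := EqQuotient.on mv_quotient.

Definition quot0 : mv_quotient := \pi_mv_quotient mv0.
Definition quot_neg (u : mv_quotient) : mv_quotient :=
  \pi_mv_quotient (¬ repr u).
Definition quot_plus (u v : mv_quotient) : mv_quotient :=
  \pi_mv_quotient (repr u ⊕ repr v).

Lemma quot_piP x y : \pi_mv_quotient x = \pi_mv_quotient y <-> I (mvdist x y).
Proof. by split=> [/eqmodP/asboolP|h] //; apply/eqmodP/asboolP. Qed.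

Lemma quot_negE x : quot_neg (\pi x) = \pi_mv_quotient (¬ x).
Proof.
apply/quot_piP/ideal_dist; rewrite !mvminusN.
have /quot_piP/ideal_dist[] := reprK (\pi_mv_quotient x).
by split.
Qed.

Lemma quot_plusE x y : quot_plus (\pi x) (\pi y) = \pi_mv_quotient (x ⊕ y).
Proof.
have /quot_piP/ideal_dist[x1 x2] := reprK (\pi_mv_quotient x).
have /quot_piP/ideal_dist[y1 y2] := reprK (\pi_mv_quotient y).
by apply/quot_piP/ideal_dist; split;
  apply: idealS (mvminus_plus _ _ _ _) _; exact: idealD.
Qed.

Fact quot_plusA : associative quot_plus.
Proof.
by elim/quotW=> x; elim/quotW=> y; elim/quotW=> z; rewrite !quot_plusE mvplusA.
Qed.

Fact quot_plusC : commutative quot_plus.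
Proof. by elim/quotW=> x; elim/quotW=> y; rewrite !quot_plusE mvplusC. Qed.

Fact quot_plus0 : right_id quot0 quot_plus.
Proof. by elim/quotW=> x; rewrite !quot_plusE mvplus0. Qed.

Fact quot_negK : involutive quot_neg.
Proof. by elim/quotW=> x; rewrite !quot_negE mvnegK. Qed.

Fact quot_plus1 u : quot_plus u (quot_neg quot0) = quot_neg quot0.
Proof. by elim/quotW: u => x; rewrite quot_negE quot_plusE mvplus1. Qed.

Fact quot_luk u v : quot_plus (quot_neg (quot_plus (quot_neg u) v)) v =
                    quot_plus (quot_neg (quot_plus (quot_neg v) u)) u.
Proof.
elim/quotW: u => x; elim/quotW: v => y.
rewrite (quot_negE x) (quot_negE y) (quot_plusE (¬ x)) (quot_plusE (¬ y)).
by rewrite !quot_negE !quot_plusE mvluk.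
Qed.

HB.instance Definition _ := isMVAlgebra.Build mv_quotient
  quot_plusA quot_plusC quot_plus0 quot_negK quot_plus1 quot_luk.

Lemma mv_hom_pi : mv_hom (\pi_mv_quotient : A -> mv_quotient).
Proof.
split=> [//|x|x y]; first by rewrite -quot_negE.
by rewrite -quot_plusE.
Qed.

End Quotient.

Section UnitInterval.
Local Open Scope ring_scope.
Variable R : realType.

Definition unit_interval : Type := set_type (`[0, 1]%classic : set R).

HB.instance Definition _ := Choice.on unit_interval.
HB.instance Definition _ :=
  Topological.copy unit_interval (set_type (`[0, 1]%classic : set R)).

Definition uval (x : unit_interval) : R := set_val x.

Lemma uval_itv (x : unit_interval) : 0 <= uval x <= 1.
Proof. by have := set_valP x; rewrite /= in_itv. Qed.

Lemma uval_inj : injective uval.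
Proof. exact: val_inj. Qed.

Definition unit_mk (r : R) (r01 : 0 <= r <= 1) : unit_interval.
Proof. by exists r; apply/mem_set; rewrite /= in_itv. Defined.

Fact unit_zero_subproof : 0 <= (0 : R) <= 1.
Proof. by rewrite lexx ler01. Qed.

Fact unit_neg_subproof (x : unit_interval) : 0 <= 1 - uval x <= 1.
Proof. by have := uval_itv x; lra. Qed.

Fact unit_plus_subproof (x y : unit_interval) :
  0 <= Num.min (uval x + uval y) 1 <= 1.
Proof.
rewrite ge_min lexx orbT andbT le_min ler01 andbT.
by have := uval_itv x; have := uval_itv y; lra.
Qed.

Definition unit_zero : unit_interval := unit_mk unit_zero_subproof.
Definition unit_neg (x : unit_interval) : unit_interval :=
  unit_mk (unit_neg_subproof x).
Definition unit_plus (x y : unit_interval) : unit_interval :=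
  unit_mk (unit_plus_subproof x y).

Let uval_mk r (r01 : 0 <= r <= 1) : uval (unit_mk r01) = r.
Proof. by []. Qed.

Fact unit_plusA : associative unit_plus.
Proof.
move=> x y z; apply: uval_inj; rewrite !uval_mk.
have := uval_itv x; have := uval_itv y; have := uval_itv z.
by rewrite !minEle; do ![case: ifPn; rewrite -?ltNge]; lra.
Qed.

Fact unit_plusC : commutative unit_plus.
Proof. by move=> x y; apply: uval_inj; rewrite !uval_mk addrC. Qed.

Fact unit_plus0 : right_id unit_zero unit_plus.
Proof.
move=> x; apply: uval_inj; rewrite !uval_mk addr0.
by apply/min_idPl; case/andP: (uval_itv x).
Qed.

Fact unit_negK : involutive unit_neg.
Proof. by move=> x; apply: uval_inj; rewrite !uval_mk; lra. Qed.

Fact unit_plus1 x : unit_plus x (unit_neg unit_zero) = unit_neg unit_zero.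
Proof.
apply: uval_inj; rewrite !uval_mk subr0; apply/min_idPr.
by have := uval_itv x; lra.
Qed.

Fact unit_luk x y : unit_plus (unit_neg (unit_plus (unit_neg x) y)) y =
                    unit_plus (unit_neg (unit_plus (unit_neg y) x)) x.
Proof.
apply: uval_inj; rewrite !uval_mk.
have := uval_itv x; have := uval_itv y.
by rewrite !minEle; do ![case: ifPn; rewrite -?ltNge]; lra.
Qed.

HB.instance Definition _ := isMVAlgebra.Build unit_interval
  unit_plusA unit_plusC unit_plus0 unit_negK unit_plus1 unit_luk.

Lemma uval_continuous : continuous uval.
Proof. exact: initial_continuous. Qed.

Lemma unit_continuousP (X : topologicalType) (f : X -> unit_interval) :
  continuous (uval \o f) -> continuous f.
Proof. by move=> fc; exact/continuous_comp_initial. Qed.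

End UnitInterval.

Section ContinuousFunctions.
Local Open Scope ring_scope.
Variables (R : realType) (X : topologicalType).

Definition mvC : Type := continuousType X (unit_interval R).

HB.instance Definition _ := Choice.on mvC.

Definition mvC_fun (f : mvC) : X -> unit_interval R :=
  (f : continuousType X (unit_interval R)).
Coercion mvC_fun : mvC >-> Funclass.

Lemma mvC_ext (f g : mvC) : f =1 g -> f = g.
Proof. by move=> fg; apply/continuousEP. Qed.

Fact mvC_neg_subproof (f : mvC) : continuous (fun t => ¬ f t).
Proof.
apply: unit_continuousP => t; apply: cvgB; first exact: cvg_cst.
by apply: continuous_comp; [exact: cts_fun|exact: uval_continuous].
Qed.

Fact mvC_plus_subproof (f g : mvC) : continuous (fun t => f t ⊕ g t).
Proof.
apply: unit_continuousP => t.
have fc (h : mvC) : {for t, continuous ((@uval R \o h) : X -> R^o)}.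
  by apply: continuous_comp; [exact: cts_fun|exact: uval_continuous].
apply: (@continuous_min _ _ (fun s => uval (f s) + uval (g s) : R^o) (cst 1)).
  exact: cvgD (fc f) (fc g).
exact: cvg_cst.
Qed.

Definition mvC0 : mvC :=
  (mkcts (@cst_continuous X (unit_interval R) mv0) : continuousType X (unit_interval R)).
Definition mvC_neg (f : mvC) : mvC :=
  (mkcts (@mvC_neg_subproof f) : continuousType X (unit_interval R)).
Definition mvC_plus (f g : mvC) : mvC :=
  (mkcts (@mvC_plus_subproof f g) : continuousType X (unit_interval R)).

Fact mvC_plusA : associative mvC_plus.
Proof. by move=> f g h; apply: mvC_ext => t; exact: mvplusA. Qed.
Fact mvC_plusC : commutative mvC_plus.
Proof. by move=> f g; apply: mvC_ext => t; exact: mvplusC. Qed.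
Fact mvC_plus0 : right_id mvC0 mvC_plus.
Proof. by move=> f; apply: mvC_ext => t; exact: mvplus0. Qed.
Fact mvC_negK : involutive mvC_neg.
Proof. by move=> f; apply: mvC_ext => t; exact: mvnegK. Qed.
Fact mvC_plus1 f : mvC_plus f (mvC_neg mvC0) = mvC_neg mvC0.
Proof. by apply: mvC_ext => t; exact: mvplus1. Qed.
Fact mvC_luk f g : mvC_plus (mvC_neg (mvC_plus (mvC_neg f) g)) g =
                   mvC_plus (mvC_neg (mvC_plus (mvC_neg g) f)) f.
Proof. by apply: mvC_ext => t; exact: mvluk. Qed.

HB.instance Definition _ := isMVAlgebra.Build mvC
  mvC_plusA mvC_plusC mvC_plus0 mvC_negK mvC_plus1 mvC_luk.

End ContinuousFunctions.

Record Max (A : mvAlgType) := MaxIdeal {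
  max_ideal :> ideal A;
  max_idealP : maximal_ideal max_ideal
}.

Section MaxTopology.
Variable A : mvAlgType.
Implicit Types (I J : ideal A) (m : Max A) (x y : A).

HB.instance Definition _ := gen_eqMixin (Max A).
HB.instance Definition _ := gen_choiceMixin (Max A).

Definition hull (I : ideal A) : set (Max A) := [set m | I `<=` m].

Definition max_open (U : set (Max A)) : Prop := exists I, ~` U = hull I.

Let id0 I : I mv0. Proof. by have [] := idealP I. Qed.
Let idS I x y : x ≼ y -> I y -> I x.
Proof. by have [_ + _] := idealP I; apply. Qed.
Let idD I x y : I x -> I y -> I (x ⊕ y).
Proof. by have [_ _ +] := idealP I; apply. Qed.

Lemma proper_idealP I : proper_ideal I <-> ~ I (mv1 A).
Proof.
split=> [/eqP IT I1|I1]; last by apply/eqP => IT; apply: I1; rewrite IT.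
by apply: IT; apply/seteqP; split=> // x _; apply: idS I1; exact: mvle1.
Qed.

Definition mv_muln n x : A := iter n (mvplus x) mv0.

Lemma mv_mulnD n k x : mv_muln (n + k) x = mv_muln n x ⊕ mv_muln k x.
Proof.
elim: n => [|n ih]; first by rewrite /mv_muln /= mvplus0l.
by rewrite addSn /mv_muln /= -!/(mv_muln _ _) ih mvplusA.
Qed.

Lemma ideal_muln I n x : I x -> I (mv_muln n x).
Proof. by move=> Ix; elim: n => [|n ih]; [exact: id0|exact: idD]. Qed.

Fact ideal_adjoin_subproof I x :
  is_ideal [set y | exists z n, I z /\ y ≼ z ⊕ mv_muln n x].
Proof.
split=> [|y y' yy' [z [n [Iz y'z]]]|y y' [z [n [Iz yz]]] [z' [n' [Iz' yz']]]].
- by exists mv0, 0%N; split; [exact: id0|exact: mv0_le].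
- by exists z, n; split=> //; exact: mvle_trans yy' y'z.
- exists (z ⊕ z'), (n + n')%N; split; first exact: idD.
  apply: mvle_trans (mvle_plus yz yz') _; rewrite mv_mulnD.
  rewrite -!mvplusA [mv_muln n x ⊕ (_ ⊕ _)]mvplusA.
  rewrite [mv_muln n x ⊕ z']mvplusC -!mvplusA; exact: mvle_refl.
Qed.

Definition ideal_adjoin I x : ideal A := Ideal (ideal_adjoin_subproof I x).

Lemma max_ideal_adjoin m x : ~ m x -> exists2 z, m z & exists n, ¬ z ≼ mv_muln n x.
Proof.
move=> mx; have [mp mM] := max_idealP m.
have : ~ proper_ideal (ideal_adjoin m x).
  move=> /mM mE; apply: mx; rewrite mE.
    exists mv0, 1%N; split; first exact: id0.
    by rewrite mvplus0l /mv_muln /= mvplus0; exact: mvle_refl.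
  by move=> y my; exists y, 0%N; split=> //; exact: mvle_plusr.
move=> /proper_idealP/contrapT[z [n [mz]]] zn; exists z => //; exists n.
by move/mvleE: zn; rewrite mvneg1 mvplus0l => zn; apply/mvleE; rewrite mvnegK.
Qed.

Fact idealI_subproof I J : is_ideal (I `&` J).
Proof.
split=> [|x y xy [Iy Jy]|x y [Ix Jx] [Iy Jy]].
- by split; exact: id0.
- by split; [exact: idS Iy|exact: idS Jy].
- by split; exact: idD.
Qed.

Definition idealI I J : ideal A := Ideal (idealI_subproof I J).

Lemma hullI I J : hull (idealI I J) = hull I `|` hull J.
Proof.
apply/seteqP; split=> m /=; last first.
  by move=> [h|h] x [] Ix Jx; apply: h.
move=> IJm; apply: contrapT => /not_orP[].
move=> /existsNP[a /not_implyP[Ia /max_ideal_adjoin[z mz [n zn]]]].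
move=> /existsNP[b /not_implyP[Jb /max_ideal_adjoin[t mt [k tk]]]].
have zt : ¬ (z ⊕ t) ≼ ¬ z.
  by apply/mvleE; rewrite mvnegK -mvplusA mvplusC -mvplusA mvplusN mvplus1.
have tz : ¬ (z ⊕ t) ≼ ¬ t.
  by apply/mvleE; rewrite mvnegK -mvplusA [t ⊕ _]mvplusC mvplusN mvplus1.
have mzt : m (¬ (z ⊕ t)).
  apply: IJm; split.
    by apply: idS (mvle_trans zt zn) _; exact: ideal_muln.
  by apply: idS (mvle_trans tz tk) _; exact: ideal_muln.
have [/proper_idealP + _] := max_idealP m; apply.
by rewrite -(mvplusN (z ⊕ t)); apply: idD => //; exact: idD.
Qed.

Fact ideal_gen_subproof (S : set A) :
  is_ideal [set x | forall I, S `<=` I -> I x].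
Proof.
split=> [I _|x y xy Sy I SI|x y Sx Sy I SI]; first exact: id0.
- by apply: idS xy _; exact: Sy.
- by apply: idD; [exact: Sx|exact: Sy].
Qed.

Definition ideal_gen (S : set A) : ideal A := Ideal (ideal_gen_subproof S).

Fact max_openT : max_open setT.
Proof.
exists (ideal_gen setT); rewrite setCT; apply/seteqP; split=> // m /= mT.
have [/proper_idealP + _] := max_idealP m; apply.
by apply: mT => I; apply.
Qed.

Fact max_openI U V : max_open U -> max_open V -> max_open (U `&` V).
Proof.
by move=> [I UI] [J VJ]; exists (idealI I J); rewrite setCI hullI UI VJ.
Qed.

Fact max_open_bigU (K : Type) (F : K -> set (Max A)) :
  (forall k, max_open (F k)) -> max_open (\bigcup_k F k).
Proof.
move=> Fo; exists (ideal_gen [set x | exists k I, ~` F k = hull I /\ I x]).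
rewrite setC_bigcup; apply/seteqP; split=> m /=.
  move=> mF x; apply => y [k [I [FI Iy]]].
  have Im : hull I m by rewrite -FI; exact: mF.
  exact: Im.
move=> mF k _; have [I FI] := Fo k; rewrite FI => x Ix.
by apply: mF => J; apply; exists k, I.
Qed.

HB.instance Definition _ :=
  isOpenTopological.Build (Max A) max_openT max_openI max_open_bigU.

Lemma max_closedP (F : set (Max A)) : closed F <-> exists I, F = hull I.
Proof.
split=> [/closed_openC[I]|[I FI]]; first by rewrite setCK; exists I.
by rewrite -(setCK F); apply: open_closedC; exists I; rewrite setCK.
Qed.

End MaxTopology.

Section Evaluation.
Variables (R : realType) (A : mvAlgType).

(* The unique MV-homomorphism from A/m to [0,1]; the default value of xget is
   only reached when there is no such homomorphism, which never happens. *)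
Definition max_hom (m : Max A) : mv_quotient m -> unit_interval R :=
  xget (fun=> mv0) [set h : mv_quotient m -> unit_interval R | mv_hom h].

Definition hat (a : A) (m : Max A) : unit_interval R :=
  max_hom (\pi_(mv_quotient m) a).

End Evaluation.

Arguments hat R {A} a m.

(* Main.v *)
Require Import Defs.
From mathcomp Require Import all_boot all_order all_algebra.
From mathcomp Require Import all_classical all_reals all_analysis.
From mathcomp Require Import zify lra.
(* Reimported so that [ideal] is the one of [Defs], not that of MathComp. *)
Import Defs.
Set Implicit Arguments.
Unset Strict Implicit.
Unset Printing Implicit Defensive.
Import Order.TTheory GRing.Theory Num.Theory.
Import numFieldNormedType.Exports.
Local Open Scope mv_scope.
Local Open Scope classical_set_scope.
Local Open Scope quotient_scope.

(* In a delta-algebra [f_{1/2}] provides dyadic constants, and these do the work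
   of Hoelder's theorem: for [m] maximal, [a |-> inf {k / 2^n | a <= k 2^-n mod m}]
   is a homomorphism to [0, 1].  Semisimplicity holds because an element below
   every [2^-n] vanishes.  Two disjoint closed sets of maximal ideals are the
   hulls of comaximal ideals, so they are separated by an element of the algebra.
   Hence every continuous [f] is within reach of binary digits: there is [a] with
   [2f - 1 <= a <= 2f], and iterating on [2f - a] writes [f] as the sum of the
   [a_i / 2^i], which is what [delta] computes.  Conversely the operation
   [sum x_i / 2^i] turns [C(X)] into a delta-algebra. *)

(** * Lattice order, disjointness and multiples in MV-algebras *)

Section MVArith.
Variable A : mvAlgType.
Implicit Types x y z : A.

Lemma mvle_anti x y : x ≼ y -> y ≼ x -> x = y.
Proof.
move=> /mvleE xy /mvleE yx; have := mvluk x y.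
by rewrite xy yx mvneg1 !mvplus0l.
Qed.

Lemma mvle0 x : x ≼ mv0 -> x = mv0.
Proof. by move=> x0; apply: mvle_anti => //; exact: mv0_le. Qed.

Lemma mvminus0 x : x ⊖ mv0 = x.
Proof. by rewrite mvminusE mvplus0 mvnegK. Qed.

Lemma mv1minus x : mv1 A ⊖ x = ¬ x.
Proof. by rewrite mvminusE mvneg1 mvplus0l. Qed.

Lemma mvminus1 x : x ⊖ mv1 A = mv0.
Proof. exact: mvle1. Qed.

Lemma mvminusD x y z : x ⊖ y ⊖ z = x ⊖ (y ⊕ z).
Proof. by rewrite !mvminusE mvnegK mvplusA. Qed.

Lemma mvneg_minus x y : ¬ (x ⊖ y) = ¬ x ⊕ y.
Proof. by rewrite mvminusE mvnegK. Qed.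

(** The left side is the lattice join of [x] and [y]; its symmetry is the axiom [mvluk]. Dually,
    [x ⊖ (x ⊖ y)] is the meet. *)
Lemma mvjoinC x y : y ⊕ (x ⊖ y) = x ⊕ (y ⊖ x).
Proof. by rewrite !mvminusE ![_ ⊕ ¬ _]mvplusC mvluk. Qed.

Lemma mvjoin_r x y : x ≼ y -> x ⊕ (y ⊖ x) = y.
Proof. by move=> xy; rewrite -mvjoinC xy mvplus0. Qed.

Lemma mvmeetC x y : x ⊖ (x ⊖ y) = y ⊖ (y ⊖ x).
Proof.
apply: (can_inj (@mvnegK A)).
by rewrite !mvneg_minus -(mvminusN y x) -(mvminusN x y) mvjoinC.
Qed.

Lemma mvmeet_r x y : x ≼ y -> y ⊖ (y ⊖ x) = x.
Proof. by move=> xy; rewrite -mvmeetC xy mvminus0. Qed.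

Lemma mvplusK x y : x ≼ ¬ y -> (x ⊕ y) ⊖ y = x.
Proof.
move=> xy; rewrite -[RHS](mvmeet_r xy) !mvminusE mvnegK.
by rewrite [x ⊕ y]mvplusC [¬ (y ⊕ x) ⊕ y]mvplusC.
Qed.

Lemma mvleN x y : x ≼ y -> ¬ y ≼ ¬ x.
Proof. by rewrite /mvle mvminusN. Qed.

Lemma mvle_minusl x y z : x ≼ y -> x ⊖ z ≼ y ⊖ z.
Proof. by move=> xy; apply/mvle_minus/(mvle_trans xy)/mvminusK. Qed.

Lemma mvle_minusr x y z : x ≼ y -> z ⊖ y ≼ z ⊖ x.
Proof. by move=> /mvleN/(mvle_minusl (¬ z)); rewrite !mvminusN. Qed.

Lemma mvminus_le x y : x ⊖ y ≼ x.
Proof. by apply/mvle_minus; rewrite mvplusC; exact: mvle_plusr. Qed.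

Lemma mvodotC x y : x ⊙ y = y ⊙ x.
Proof. by rewrite /mvodot mvplusC. Qed.

Lemma mvodotA x y z : x ⊙ (y ⊙ z) = x ⊙ y ⊙ z.
Proof. by rewrite /mvodot !mvnegK mvplusA. Qed.

Lemma mvodotK x y : x ⊙ (¬ x ⊕ y) = y ⊙ (¬ y ⊕ x).
Proof. by have := mvmeetC x y; rewrite {1 3}/mvminus !mvneg_minus. Qed.

Lemma mvodot_le x y z : x ≼ y -> z ⊙ x ≼ z ⊙ y.
Proof.
by move=> xy; rewrite -(mvnegK x) -(mvnegK y); apply: mvle_minusr; exact: mvleN.
Qed.

Lemma mvodot_ler x y : x ⊙ y ≼ x.
Proof. by rewrite -(mvnegK y); exact: mvminus_le. Qed.

(** Equivalently, [x ⊖ y] and [y ⊖ x] have meet [mv0]. Written as a product and rearranged by the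
    symmetry of meets, this meet is bounded by [¬ x ⊙ ¬ (¬ x ⊕ b)], which vanishes. *)
Lemma mv_prelinear x y : (x ⊖ y) ⊖ (y ⊖ x) = x ⊖ y.
Proof.
apply: mvle_anti; first exact: mvminus_le.
have aE (u v : A) : u ⊖ (u ⊖ v) = u ⊙ (¬ u ⊕ v) by rewrite -[in RHS]mvneg_minus.
rewrite /mvle aE mvneg_minus; set b := y ⊖ x.
have -> : (x ⊖ y) ⊙ (¬ x ⊕ y ⊕ b) = x ⊙ (¬ y ⊙ (y ⊕ (¬ x ⊕ b))).
  by rewrite mvodotA [y ⊕ _]mvplusA [y ⊕ ¬ x]mvplusC.
have -> : ¬ y ⊙ (y ⊕ (¬ x ⊕ b)) = (¬ x ⊕ b) ⊙ (¬ (¬ x ⊕ b) ⊕ ¬ y).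
  by rewrite -mvodotK mvnegK.
rewrite mvodotA mvodotK; apply: mvle0.
set w := ¬ x ⊕ b.
have bw : b ⊙ (¬ w ⊕ ¬ y) ≼ ¬ x ⊙ ¬ w.
  rewrite /b /mvminus -/b [y ⊙ _]mvodotC -mvodotA; apply: mvodot_le.
  by rewrite [¬ w ⊕ _]mvplusC mvodotK; exact: mvodot_ler.
have w0 : ¬ x ⊙ ¬ w = mv0.
  by rewrite /mvodot /w !mvnegK mvplusA [x ⊕ _]mvplusC mvplusN mvplus1l mvneg1.
rewrite -w0; apply: mvle_trans bw.
rewrite -mvodotA [_ ⊙ (¬ w ⊕ _)]mvodotC mvodotA; exact: mvodot_ler.
Qed.

(** The equation [x ⊖ y = x] expresses that [x] and [y] are disjoint; disjointness passes to the
    multiples of [y]. *)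
Lemma mvminus_muln x y n : x ⊖ y = x -> x ⊖ mv_muln n y = x.
Proof.
move=> xy; elim: n => [|n ih]; first exact: mvminus0.
by rewrite /mv_muln /= -mvminusD xy.
Qed.

Lemma mv_muln_le n k x : (n <= k)%N -> mv_muln n x ≼ mv_muln k x.
Proof. by move=> /subnKC <-; rewrite mv_mulnD; exact: mvle_plusr. Qed.

Lemma mv_muln_double n x : mv_muln n (x ⊕ x) = mv_muln n.*2 x.
Proof. by elim: n => //= n ih; rewrite /mv_muln /= -!/(mv_muln _ _) ih mvplusA. Qed.

Lemma mv_muln1 x : mv_muln 1 x = x.
Proof. exact: mvplus0. Qed.

Lemma mv_muln_mul j k x : mv_muln j (mv_muln k x) = mv_muln (j * k) x.
Proof.
elim: j => //= j ih; rewrite mulSn mv_mulnD -ih.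
by rewrite {1}/mv_muln /= -!/(mv_muln _ _).
Qed.

(** The hypotheses make [e] behave like [1/N]. Removing one copy of [e] is exact because the
    remaining multiple lies below [¬ e], so that no truncation occurred. *)
Lemma mv_mulnN N e k : mv_muln N e = mv1 A -> ¬ e = mv_muln N.-1 e ->
  (k <= N)%N -> ¬ mv_muln k e = mv_muln (N - k) e.
Proof.
move=> Ne Ne1; elim: k => [_|k ih kN]; first by rewrite subn0 Ne.
rewrite /mv_muln /= -/(mv_muln k e) mvplusC.
rewrite -[mv_muln k e in LHS]mvnegK -mvminusE ih ?(ltnW kN)//.
have -> : (N - k = (N - k.+1) + 1)%N by rewrite addn1 subnSK.
rewrite mv_mulnD mv_muln1 mvplusK// Ne1.
by apply: mv_muln_le; rewrite subnS -!subn1 leq_sub2r// leq_subr.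
Qed.

End MVArith.

(** * Existence of maximal ideals and order modulo a maximal ideal *)

Section MaximalIdeals.
Variable A : mvAlgType.
Implicit Types (I J : ideal A) (m : Max A) (x y z : A).

Lemma ideal_mv0 I : I mv0.
Proof. by have [] := idealP I. Qed.

Lemma ideal_le I x y : x ≼ y -> I y -> I x.
Proof. by have [_ + _] := idealP I; apply. Qed.

Lemma ideal_plus I x y : I x -> I y -> I (x ⊕ y).
Proof. by have [_ _ +] := idealP I; apply. Qed.

Lemma ideal_minus_trans I y x z : I (x ⊖ y) -> I (y ⊖ z) -> I (x ⊖ z).
Proof.
by move=> xy yz; apply: ideal_le (mvminus_trans y x z) _; exact: ideal_plus.
Qed.

Lemma ideal_minus_plus I x y z t :
  I (x ⊖ z) -> I (y ⊖ t) -> I ((x ⊕ y) ⊖ (z ⊕ t)).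
Proof.
by move=> xz yt; apply: ideal_le (mvminus_plus x y z t) _; exact: ideal_plus.
Qed.

Lemma ideal_minus_le I x y : x ≼ y -> I (x ⊖ y).
Proof. by rewrite /mvle => ->; exact: ideal_mv0. Qed.

Lemma max_ideal_neq1 m : ~ m (mv1 A).
Proof. by apply/proper_idealP; case: (max_idealP m). Qed.

Lemma exists_max_ideal I : proper_ideal I -> exists m : Max A, I `<=` m.
Proof.
move=> /proper_idealP I1.
(* Zorn's lemma is applied to the sets [S] through [I ∪ S], so that the empty chain, with empty
   union, still yields the ideal [I]. *)
pose P (S : set A) := is_ideal ((I : set A) `|` S) /\ ~ ((I : set A) `|` S) (mv1 A).
have [F FP Ftot|S [[Sid S1] Smax]] := @Zorn_bigcup A P.
  split; last by case=> // -[X FX X1]; case: (FP _ FX) => _; apply; right.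
  split; first by left; exact: ideal_mv0.
    move=> x y xy [Iy|[X FX Xy]]; first by left; exact: ideal_le Iy.
    have [[_ Xle _] _] := FP _ FX.
    by case: (Xle _ _ xy (or_intror Xy)) => [|Xx]; [left|right; exists X].
  have sumX X x y : F X -> ((I : set A) `|` X) x -> ((I : set A) `|` X) y ->
      ((I : set A) `|` \bigcup_(X in F) X) (x ⊕ y).
    move=> FX Xx Xy; have [[_ _ Xplus] _] := FP _ FX.
    by case: (Xplus _ _ Xx Xy) => [|Xs]; [left|right; exists X].
  move=> x y [Ix|[X FX Xx]] [Iy|[Y FY Yy]].
  - by left; exact: ideal_plus.
  - by apply: (sumX Y); [|left|right].
  - by apply: (sumX X); [|right|left].
  - have [XY|YX] := Ftot _ _ FX FY.
    + by apply: (sumX Y) => //; right => //; exact: XY.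
    + by apply: (sumX X) => //; right => //; exact: YX.
pose M := Ideal Sid.
have Mmax : maximal_ideal M.
  split; first exact/proper_idealP.
  move=> J /proper_idealP J1 MJ; apply/seteqP; split=> //.
  have IJ : (I : set A) `|` J = J by apply/setUidPr => x Ix; apply: MJ; left.
  apply: contrapT => JM; apply: (Smax J).
    split; first by move=> x Sx; apply: MJ; right.
    by move=> JS; apply: JM => x /JS; right.
  by rewrite /P IJ; split => //; exact: idealP.
by exists (MaxIdeal Mmax) => x Ix; left.
Qed.

(** If [x ⊖ y] is not in [m], then [¬ z ≼ n (x ⊖ y)] for some [z] in [m]. Since [y ⊖ x] is disjoint
    from [n (x ⊖ y)], it equals its difference with that multiple and hence lies below [z]. *)
Lemma max_ideal_minus_total m x y : m (x ⊖ y) \/ m (y ⊖ x).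
Proof.
have [|mxy] := pselect (m (x ⊖ y)); [by left|right].
have [z mz [n zn]] := max_ideal_adjoin mxy.
apply: ideal_le mz; rewrite -(mvminus_muln n (mv_prelinear y x)).
apply: mvle_trans (mvle_minusr _ zn) _.
by rewrite /mvminus mvnegK mvodotC; exact: mvodot_ler.
Qed.

Fact ideal_sum_subproof I J :
  is_ideal [set z | exists i j, [/\ I i, J j & z ≼ i ⊕ j]].
Proof.
split=> [|x y xy [i [j [Ii Jj yij]]]|x y [i [j [Ii Jj xij]]] [k [l [Ik Jl ykl]]]].
- by exists mv0, mv0; split; [exact: ideal_mv0..|exact: mv0_le].
- by exists i, j; split=> //; exact: mvle_trans yij.
- exists (i ⊕ k), (j ⊕ l); split; [exact: ideal_plus..|].
  have -> : i ⊕ k ⊕ (j ⊕ l) = (i ⊕ j) ⊕ (k ⊕ l).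
    by rewrite -!mvplusA; congr mvplus; rewrite !mvplusA [k ⊕ j]mvplusC.
  exact: mvle_plus.
Qed.

Definition ideal_sum I J : ideal A := Ideal (ideal_sum_subproof I J).

(** A maximal ideal above [I + J] would lie in both hulls; hence [I + J] is improper and contains
    [1]. *)
Lemma hull_disjoint I J : hull I `&` hull J = set0 ->
  exists i j, [/\ I i, J j & i ⊕ j = mv1 A].
Proof.
move=> IJ0; have [/exists_max_ideal[m IJm]|] := pselect (proper_ideal (ideal_sum I J)).
  suff : (hull I `&` hull J) m by rewrite IJ0.
  split=> x xIJ; apply: IJm.
    exists x, mv0; rewrite mvplus0; split=> //; first exact: ideal_mv0.
    exact: mvle_refl.
  exists mv0, x; rewrite mvplus0l; split=> //; first exact: ideal_mv0.
  exact: mvle_refl.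
move=> /proper_idealP/contrapT[i [j [Ii Jj ij]]]; exists i, j; split=> //.
by apply: mvle_anti => //; exact: mvle1.
Qed.

Fact ideal_zero_subproof : is_ideal [set mv0 : A].
Proof.
split=> [//|x y xy /= y0|x y /= -> ->]; last by rewrite mvplus0.
by apply: mvle0; rewrite -y0.
Qed.

(** The ideal generated by [y ⊖ x] is proper: if some multiple of [y ⊖ x] were [1], then [x ⊖ y],
    being disjoint from it, would be [mv0]. *)
Lemma exists_max_ideal_minus x y : ~ x ≼ y -> exists m : Max A, m (y ⊖ x).
Proof.
move=> xy; pose I := ideal_adjoin (Ideal ideal_zero_subproof) (y ⊖ x).
have [|m Im] := @exists_max_ideal I.
  apply/proper_idealP => -[z [n [/= -> ]]]; rewrite mvplus0l => n1; apply: xy.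
  rewrite /mvle -(mvminus_muln n (mv_prelinear x y)).
  apply: mvle0; apply: mvle_trans (mvle_minusr _ n1) _.
  by rewrite mvminus1; exact: mvle_refl.
exists m; apply: Im; exists mv0, 1%N; split=> //.
by rewrite mvplus0l mv_muln1; exact: mvle_refl.
Qed.

End MaximalIdeals.

(** * Halving, dyadic constants and semisimplicity of delta-algebras *)

Section DeltaArith.
Variable D : deltaAlgType.
Implicit Types (x y : D) (s : nat -> D).

Definition mvhalf x : D := half_of delta x.

Definition mvdyadic n : D := iter n mvhalf (mv1 D).

Lemma mvhalf_delta s : mvhalf (s 0%N) ≼ delta s.
Proof.
suff -> : delta s = delta (fun n => scons (s 0%N) (fun=> mv0) n ⊕
    scons mv0 (fun n => s n.+1) n) by exact: deltaA5.
by congr delta; apply/funext => -[|n] /=; rewrite ?mvplus0 ?mvplus0l.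
Qed.

Lemma mvhalf_le x : mvhalf x ≼ x.
Proof. by rewrite -{2}(deltaA3 x); exact: mvhalf_delta. Qed.

(** Algebraic form of the recursion [delta s = (s 0 + delta (shifted s)) / 2]: by [mvhalf_delta] one
    side of the distance in [deltaA1] vanishes, and [deltaA4] rewrites the other member. *)
Lemma delta_minus_half s :
  delta s ⊖ mvhalf (s 0%N) = mvhalf (delta (fun n => s n.+1)).
Proof.
have := deltaA1 s; rewrite deltaA4 /mvdist.
by rewrite (_ : _ ⊖ delta s = mv0) ?mvplus0//; exact: mvhalf_delta.
Qed.

Lemma mvminus_half x : x ⊖ mvhalf x = mvhalf x.
Proof. by have := delta_minus_half (fun=> x); rewrite deltaA3. Qed.

Lemma mvhalfD x : mvhalf x ⊕ mvhalf x = x.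
Proof. by rewrite -{2}mvminus_half mvjoin_r//; exact: mvhalf_le. Qed.

(** With [x ⊕ x = ¬ (¬ x ⊖ x)], the axiom [deltaA6] turns the half into [1/2 ⊖ (1/2 ⊖ x)], the meet
    of [1/2] and [x]. *)
Lemma mvhalf_double x : x ≼ mvhalf (mv1 D) -> mvhalf (x ⊕ x) = x.
Proof.
move=> x2.
have halfN y : mvhalf (¬ y) = mvhalf (mv1 D) ⊖ mvhalf y.
  by rewrite -mv1minus; exact: deltaA6.
have -> : x ⊕ x = ¬ (¬ x ⊖ x) by rewrite mvneg_minus mvnegK.
rewrite halfN [mvhalf (_ ⊖ _)]deltaA6 -!/(mvhalf _) halfN.
by rewrite mvminusD mvhalfD mvmeet_r.
Qed.

Lemma mvdyadicD n : mvdyadic n.+1 ⊕ mvdyadic n.+1 = mvdyadic n.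
Proof. exact: mvhalfD. Qed.

Lemma mvdyadic_scale n k : mvdyadic n = mv_muln (2 ^ k) (mvdyadic (n + k)).
Proof.
elim: k => [|k ih]; first by rewrite addn0 mv_muln1.
by rewrite ih addnS -mvdyadicD mv_muln_double expnS mul2n.
Qed.

Lemma mvdyadic_mul1 n : mv_muln (2 ^ n) (mvdyadic n) = mv1 D.
Proof. by have := mvdyadic_scale 0 n; rewrite add0n => <-. Qed.

Lemma mvdyadicN n : ¬ mvdyadic n = mv_muln (2 ^ n).-1 (mvdyadic n).
Proof.
elim: n => [|n ih]; first exact: mvneg1.
have -> : (2 ^ n.+1).-1 = ((2 ^ n).-1.*2 + 1)%N.
  rewrite expnS mul2n addn1 -{1}(prednK (expn_gt0 2 n)).
  by rewrite doubleS.
rewrite mv_mulnD -mv_muln_double mvdyadicD -ih mv_muln1.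
by rewrite -mvneg_minus {2}/mvdyadic /= -/(mvdyadic n) mvminus_half.
Qed.

Lemma mv_muln_dyadicN n k : (k <= 2 ^ n)%N ->
  ¬ mv_muln k (mvdyadic n) = mv_muln (2 ^ n - k) (mvdyadic n).
Proof. by apply: mv_mulnN; [exact: mvdyadic_mul1|exact: mvdyadicN]. Qed.

(* If [x] is infinitesimal then [z := delta (2x, 4x, 8x, ...)] satisfies
   [z = x + z]. *)
Lemma mvdyadic_archimedean x : (forall n, x ≼ mvdyadic n) -> x = mv0.
Proof.
move=> xinf; pose s n := iter n (fun y => y ⊕ y) x.
have sinf n k : s n ≼ mvdyadic k.
  elim: n k => [|n ih] k; first exact: xinf.
  by rewrite /s /= -/(s n) -mvdyadicD; apply: mvle_plus.
have halfs n : mvhalf (s n.+1) = s n.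
  by apply: mvhalf_double; exact: (sinf n 1%N).
pose z := delta (fun n => s n.+1).
have xz : x ≼ z by rewrite -[x](halfs 0%N); exact: mvhalf_delta.
have zx : z ⊖ x = z.
  rewrite -{1}[x](halfs 0%N) (delta_minus_half (fun n => s n.+1)).
  by rewrite /mvhalf deltaA2; congr delta; apply/funext => n; exact: halfs.
by rewrite -(mvmeet_r xz) zx mvminusxx.
Qed.

Lemma max_ideal_dyadic (m : Max D) n : ~ m (mvdyadic n).
Proof.
by move=> /(ideal_muln (2 ^ n)); rewrite mvdyadic_mul1; exact: max_ideal_neq1.
Qed.

(** If [x] is not below [2^-n], some maximal ideal contains [2^-n ⊖ x], hence also [2^-n], whose
    [2^n]-fold multiple is [1]. *)
Lemma delta_semisimple x : (forall m : Max D, m x) -> x = mv0.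
Proof.
move=> mx; apply: mvdyadic_archimedean => n; apply: contrapT.
move=> /exists_max_ideal_minus[m me]; apply: (@max_ideal_dyadic m n).
apply: ideal_le (ideal_plus (mx m) me); exact: mvminusK.
Qed.

End DeltaArith.

(** * The homomorphism to the unit interval given by dyadic upper bounds *)

Section Holder.
Local Open Scope ring_scope.
Variables (R : realType) (D : deltaAlgType) (m : Max D).
Implicit Types a b : D.

Local Notation dyad k n := (mv_muln k (mvdyadic D n)).

(** Over the common denominator [2^N], [K > L] would put [2^-N] below the difference and so into
    [m]. The bound on [k] ensures that the larger multiple is not truncated at [1]. *)
Lemma dyad_le k n l j : (k <= 2 ^ n)%N -> m (dyad k n ⊖ dyad l j) ->
  (k%:R / 2 ^+ n : R) <= l%:R / 2 ^+ j.
Proof.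
move=> kn; rewrite ler_pdivrMr ?exprn_gt0// mulrAC ler_pdivlMr ?exprn_gt0//.
rewrite -!natrX -!natrM ler_nat.
have -> : dyad k n = dyad (k * 2 ^ j) (n + j).
  by rewrite (mvdyadic_scale D n j) mv_muln_mul.
have -> : dyad l j = dyad (l * 2 ^ n) (n + j).
  by rewrite (mvdyadic_scale D j n) mv_muln_mul addnC.
set N := (n + j)%N; set K := (k * _)%N; set L := (l * _)%N => mKL.
have KN : (K <= 2 ^ N)%N by rewrite /K /N expnD leq_mul2r kn orbT.
rewrite leqNgt; apply/negP => LK; apply: (@max_ideal_dyadic D m N).
apply: ideal_le mKL; rewrite mvminusE mv_muln_dyadicN// -mv_mulnD.
rewrite mv_muln_dyadicN; last by lia.
rewrite -[X in X ≼ _]mv_muln1; apply: mv_muln_le; lia.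
Qed.

Definition holder_ub a : set R :=
  [set r | exists n k, r = k%:R / 2 ^+ n /\ m (a ⊖ dyad k n)].

Definition holder a : R := inf (holder_ub a).

Lemma holder_le a k n : m (a ⊖ dyad k n) -> holder a <= k%:R / 2 ^+ n.
Proof.
move=> ma; apply: ge_inf; last by exists n, k.
by exists 0 => _ [j [l [-> _]]]; rewrite divr_ge0// exprn_ge0.
Qed.

Lemma le_holder a r :
  (forall k n, m (a ⊖ dyad k n) -> r <= k%:R / 2 ^+ n) -> r <= holder a.
Proof.
move=> rle; apply: lb_le_inf => [|_ [n [k [-> ma]]]]; last exact: rle.
exists (1%:R / 2 ^+ 0), 0%N, 1%N; split=> //.
by rewrite mv_muln1 mvminus1; exact: ideal_mv0.
Qed.

Lemma dyad_le_holder a k n :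
  (k <= 2 ^ n)%N -> m (dyad k n ⊖ a) -> k%:R / 2 ^+ n <= holder a.
Proof.
move=> kn ka; apply: le_holder => l j al; apply: dyad_le => //.
exact: ideal_minus_trans al.
Qed.

(** The least numerator bounding [a] from above is taken; by totality modulo [m], the failure of its
    predecessor becomes a lower bound. *)
Lemma holder_approx a n : exists k,
  [/\ (k < 2 ^ n)%N, m (dyad k n ⊖ a) & m (a ⊖ dyad k.+1 n)].
Proof.
have n1 : `[< m (a ⊖ dyad (2 ^ n) n) >].
  by apply/asboolP; rewrite mvdyadic_mul1 mvminus1; exact: ideal_mv0.
have ex : exists k, `[< m (a ⊖ dyad k n) >] by exists (2 ^ n)%N.
case: (ex_minnP ex) => -[|k] /asboolP ak kmin.
  (* A least numerator [0] has no predecessor, but [k = 0] still qualifies. *)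
  exists 0%N; split; first by rewrite expn_gt0.
    by apply: ideal_minus_le; exact: mv0_le.
  by apply: ideal_le ak; apply: mvle_minusr; exact: mv0_le.
exists k; split => //; first exact: kmin.
have [//|ak'] := max_ideal_minus_total m (dyad k n) a.
by have := kmin k; rewrite ltnn => /(_ (asboolT ak')).
Qed.

(** The slack [2 / 2^n] accommodates the combined error of two approximations at level [n]. *)
Lemma le_half_pow (x y : R) : (forall n, x <= y + 2 / 2 ^+ n) -> x <= y.
Proof.
move=> xy; apply/ler_addgt0Pr => e e0.
have := near_infty_natSinv_expn_lt (PosNum (divr_gt0 e0 (ltr0n R 2))).
case=> n _ /(_ n (leqnn n)) /= ne; apply: le_trans (xy n) _.
by rewrite lerD2l; move: ne; rewrite div1r; lra.
Qed.

Lemma holder_bounds a : 0 <= holder a <= 1.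
Proof.
apply/andP; split.
  by apply: le_holder => k n _; rewrite divr_ge0// exprn_ge0.
have := @holder_le a 1 0; rewrite expr0 divr1; apply.
by rewrite mv_muln1 mvminus1; exact: ideal_mv0.
Qed.

Lemma holder_mono a b : m (a ⊖ b) -> holder a <= holder b.
Proof.
by move=> ab; apply: le_holder => k n /(ideal_minus_trans ab)/holder_le.
Qed.

Lemma holder0 : holder mv0 = 0.
Proof.
apply/le_anti; case/andP: (holder_bounds mv0) => -> _; rewrite andbT.
have := @holder_le mv0 0 0; rewrite mul0r; apply.
by apply: ideal_minus_le; exact: mvle_refl.
Qed.

(** Complements of dyadic multiples are exact, so a bracket of width [2^-n] around [a] reflects to
    one around [¬ a]. *)
Lemma holder_neg a : holder (¬ a) = 1 - holder a.
Proof.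
have two_gt0 n : 0 < 2 ^+ n :> R by rewrite exprn_gt0.
have key n : exists r : R, [/\ r <= holder a, holder a <= r + 1 / 2 ^+ n,
    holder (¬ a) <= 1 - r & 1 - r - 1 / 2 ^+ n <= holder (¬ a)].
  have [k [kn ka ak]] := holder_approx a n.
  exists (k%:R / 2 ^+ n); split.
  - exact: dyad_le_holder (ltnW kn) ka.
  - by rewrite -mulrDl natr1; exact: holder_le ak.
  - have -> : 1 - k%:R / 2 ^+ n = (2 ^ n - k)%:R / 2 ^+ n :> R.
      by rewrite natrB ?(ltnW kn)// natrX mulrBl divff// gt_eqF.
    by apply: holder_le; rewrite -mv_muln_dyadicN ?(ltnW kn)// mvminusN.
  - have -> : 1 - k%:R / 2 ^+ n - 1 / 2 ^+ n = (2 ^ n - k.+1)%:R / 2 ^+ n :> R.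
      rewrite natrB// -[k.+1]addn1 natrD natrX mulrBl divff ?gt_eqF// mulrDl opprD.
      by rewrite addrA.
    apply: dyad_le_holder; first exact: leq_subr.
    by rewrite -mv_muln_dyadicN// mvminusN.
apply/le_anti/andP; split; apply: le_half_pow => n; have [r []] := key n;
  by have := two_gt0 n; rewrite -invr_gt0; lra.
Qed.

Lemma holder_plus a b : holder (a ⊕ b) = Num.min (holder a + holder b) 1.
Proof.
have key n : exists r s : R, [/\ r <= holder a, s <= holder b,
    holder a <= r + 1 / 2 ^+ n, holder b <= s + 1 / 2 ^+ n &
    holder (a ⊕ b) <= r + s + 2 / 2 ^+ n /\
    (r + s <= holder (a ⊕ b) \/ 1 <= holder (a ⊕ b))].
  have [k [kn ka ak]] := holder_approx a n.
  have [l [ln lb bl]] := holder_approx b n.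
  exists (k%:R / 2 ^+ n), (l%:R / 2 ^+ n); split.
  - exact: dyad_le_holder (ltnW kn) ka.
  - exact: dyad_le_holder (ltnW ln) lb.
  - by rewrite -mulrDl natr1; exact: holder_le ak.
  - by rewrite -mulrDl natr1; exact: holder_le bl.
  split.
    have -> : k%:R / 2 ^+ n + l%:R / 2 ^+ n + 2 / 2 ^+ n =
              (k.+1 + l.+1)%:R / 2 ^+ n :> R.
      by rewrite -!mulrDl -[k.+1]addn1 -[l.+1]addn1 !natrD; congr (_ / _); lra.
    by apply: holder_le; rewrite mv_mulnD; exact: ideal_minus_plus.
  have klab : m (dyad (k + l) n ⊖ (a ⊕ b)).
    by rewrite mv_mulnD; exact: ideal_minus_plus.
  (* The two cases give the two arguments of the minimum: beyond [2^n] the multiple is truncated,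
     and comparison with the numerator [2^n] yields the lower bound [1]. *)
  have [kln|kln] := leqP (k + l) (2 ^ n).
    by left; rewrite -mulrDl -natrD; exact: dyad_le_holder klab.
  right; have -> : 1 = (2 ^ n)%:R / 2 ^+ n :> R.
    by rewrite natrX divff// expf_neq0// pnatr_eq0.
  apply: dyad_le_holder => //; apply: ideal_le klab.
  by apply: mvle_minusl; apply: mv_muln_le; exact: ltnW.
apply/le_anti/andP; split.
  rewrite le_min; case/andP: (holder_bounds (a ⊕ b)) => _ ->; rewrite andbT.
  by apply: le_half_pow => n; have [r [s [? ? _ _ []]]] := key n; lra.
apply: le_half_pow => n; have [r [s [? ? ? ? [_ ?]]]] := key n.
have : 0 < 2 ^+ n :> R by rewrite exprn_gt0.
rewrite -invr_gt0 ge_min => e0.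
have [] : r + s <= holder (a ⊕ b) \/ 1 <= holder (a ⊕ b) by [].
  by move=> ?; apply/orP; left; lra.
by move=> ?; apply/orP; right; lra.
Qed.

Definition holder_hom (q : mv_quotient m) : unit_interval R :=
  unit_mk (holder_bounds (repr q)).

Lemma holder_hom_pi a : uval (holder_hom (\pi_(mv_quotient m) a)) = holder a.
Proof.
have /quot_piP/ideal_dist[ra ar] := reprK (\pi_(mv_quotient m) a).
by apply/le_anti; rewrite !holder_mono.
Qed.

Lemma holder_hom_mv_hom : mv_hom holder_hom.
Proof.
have [pi0 piN piD] := mv_hom_pi m.
split=> [|u|u v]; apply: uval_inj.
- by rewrite -pi0 holder_hom_pi holder0.
- by elim/quotW: u => a; rewrite -piN holder_hom_pi holder_neg -holder_hom_pi.
- elim/quotW: u => a; elim/quotW: v => b.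
  by rewrite -piD holder_hom_pi holder_plus -!holder_hom_pi.
Qed.

(** [holder_hom] shows that the set from which [xget] selects is inhabited, so the default value is
    not taken. *)
Lemma hat_mv_hom : mv_hom (fun a => hat R a m).
Proof.
have [h0 hN hD] : mv_hom (@max_hom R D m).
  by apply: xgetPex; exists holder_hom; exact: holder_hom_mv_hom.
have [pi0 piN piD] := mv_hom_pi m.
by split=> [|a|a b]; rewrite /hat ?pi0 ?piN ?piD.
Qed.

End Holder.

(** * Real-valued formulas for homomorphisms to the unit interval *)

Section UnitIntervalHom.
Local Open Scope ring_scope.
Variables (R : realType) (A : mvAlgType) (h : A -> unit_interval R).
Hypothesis hh : mv_hom h.

Let h0 : h mv0 = mv0. Proof. by case: hh. Qed.
Let hN a : h (¬ a) = ¬ h a. Proof. by case: hh => _ + _; apply. Qed.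
Let hD a b : h (a ⊕ b) = h a ⊕ h b. Proof. by case: hh => _ _; apply. Qed.

Lemma uval_hom0 : uval (h mv0) = 0. Proof. by rewrite h0. Qed.

Lemma uval_homN a : uval (h (¬ a)) = 1 - uval (h a). Proof. by rewrite hN. Qed.

Lemma uval_homD a b :
  uval (h (a ⊕ b)) = Num.min (uval (h a) + uval (h b)) 1.
Proof. by rewrite hD. Qed.

Lemma uval_hom1 : uval (h (mv1 A)) = 1.
Proof. by rewrite uval_homN uval_hom0 subr0. Qed.

Lemma uval_hom_minus a b :
  uval (h (a ⊖ b)) = Num.max (uval (h a) - uval (h b)) 0.
Proof.
rewrite mvminusE uval_homN uval_homD uval_homN.
by rewrite maxEle minEle; do ![case: ifPn; rewrite -?ltNge]; lra.
Qed.

Lemma uval_hom_le a b : a ≼ b -> uval (h a) <= uval (h b).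
Proof.
move=> ab; have := uval_hom_minus a b; rewrite ab uval_hom0 => /esym/eqP.
by rewrite eq_maxr subr_le0.
Qed.

End UnitIntervalHom.

(** * Injectivity, continuity and surjectivity of the evaluation map *)

Section HatDelta.
Local Open Scope ring_scope.
Variables (R : realType) (D : deltaAlgType).
Implicit Types (m : Max D) (a b : D).

Local Notation ev a m := (uval (hat R a m)).

(** The kernel of evaluation at [m] is a proper ideal containing [m], so it equals [m] by
    maximality. *)
Lemma hat_eq0 a m : ev a m = 0 <-> m a.
Proof.
have hm := hat_mv_hom R m.
have hat0 b : m b -> ev b m = 0.
  move=> mb; suff -> : hat R b m = hat R mv0 m by rewrite (uval_hom0 hm).
  congr max_hom; apply/quot_piP/ideal_dist.
  by rewrite mvminus0; split => //; apply: ideal_minus_le; exact: mv0_le.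
split=> [a0|]; last exact: hat0.
have kerI : is_ideal [set b | ev b m = 0].
  split=> [|x y xy /= y0|x y /= x0 y0]; first exact: (uval_hom0 hm).
    apply/le_anti; rewrite -{1}y0 (uval_hom_le hm xy).
    by case/andP: (uval_itv (hat R x m)).
  by rewrite (uval_homD hm) x0 y0 addr0 min_l// ler01.
have [_ /(_ (Ideal kerI))] := max_idealP m.
have kerp : proper_ideal (Ideal kerI).
  by apply/proper_idealP => /= /eqP; rewrite (uval_hom1 hm) oner_eq0.
by move=> /(_ kerp) ->.
Qed.

Lemma hat_sub_half (a c : D) m : mvhalf a ≼ c ->
  ev (c ⊖ mvhalf a) m = ev c m - ev (mvhalf a) m.
Proof.
have hm := hat_mv_hom R m.
by move=> /(uval_hom_le hm) ac; rewrite (uval_hom_minus hm) max_l// subr_ge0.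
Qed.

Lemma hat_half a m : ev (mvhalf a) m = ev a m / 2.
Proof.
have := hat_sub_half m (mvhalf_le a); rewrite mvminus_half; lra.
Qed.

Lemma hat_delta (s : nat -> D) m :
  ev (delta s) m = (ev (s 0%N) m + ev (delta (fun n => s n.+1)) m) / 2.
Proof.
have := hat_sub_half m (mvhalf_delta s).
by rewrite delta_minus_half !hat_half; lra.
Qed.

Lemma hat_dyadic n m : ev (mvdyadic D n) m = (2 ^+ n)^-1.
Proof.
elim: n => [|n ih]; first by rewrite expr0 invr1 (uval_hom1 (hat_mv_hom R m)).
by rewrite [mvdyadic D n.+1]/(mvhalf _) hat_half ih exprS invfM mulrC.
Qed.

Lemma hat_muln_dyadic k n m : (k <= 2 ^ n)%N ->
  ev (mv_muln k (mvdyadic D n)) m = k%:R / 2 ^+ n.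
Proof.
have hm := hat_mv_hom R m.
elim: k => [_|k ih kn]; first by rewrite mul0r (uval_hom0 hm).
rewrite {1}/mv_muln /= -/(mv_muln _ _) (uval_homD hm) ih ?(ltnW kn)//.
rewrite hat_dyadic -[k.+1]addn1 natrD mulrDl addrC mul1r min_l//.
rewrite -[X in _ + X]mul1r -mulrDl ler_pdivrMr ?exprn_gt0// mul1r.
by rewrite natr1 -natrX ler_nat.
Qed.

Lemma hat_inj a b : hat R a =1 hat R b -> a = b.
Proof.
have sub0 (x y : D) : hat R x =1 hat R y -> x ⊖ y = mv0.
  move=> xy; apply: delta_semisimple => m; apply/hat_eq0.
  by rewrite (uval_hom_minus (hat_mv_hom R m)) xy subrr maxxx.
by move=> ab; apply: mvle_anti; apply: sub0 => // m; rewrite ab.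
Qed.

Lemma open_notin_max (b : D) : open [set m : Max D | ~ m b].
Proof.
exists (ideal_gen [set b]); apply/seteqP; split=> m /=.
  by move=> /contrapT mb x; apply => y ->.
by move=> bm; apply; apply: bm; rewrite /ideal_gen /= => J; apply.
Qed.

(** A dyadic constant [q] with [ev a m < q < r] is chosen; the condition that [q ⊖ a] is not in [m']
    is open, holds at [m], and forces [ev a m' < q]. *)
Lemma near_hat_lt a m r : ev a m < r -> \forall m' \near m, ev a m' < r.
Proof.
(* Dyadic constants only reach [1]; for [r > 1] the bound holds everywhere. *)
have [r1 _|r1 ar] := ltP 1 r.
  apply: filterE => m'; apply: le_lt_trans r1.
  by case/andP: (uval_itv (hat R a m')).
have ra0 : 0 < r - ev a m by rewrite subr_gt0.
case: (near_infty_natSinv_expn_lt (PosNum ra0)) => n _ /(_ n (leqnn n)) /= nr.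
have n0 : 0 < 2 ^+ n :> R by rewrite exprn_gt0.
have [a0 a1] := andP (uval_itv (hat R a m)).
(* The least numerator with [k / 2^n] strictly above [ev a m]; it exceeds that value by at most
   [2^-n], hence stays below [r]. *)
pose k := (Num.truncn (ev a m * 2 ^+ n)).+1.
have /andP[ka ak] : k.-1%:R <= ev a m * 2 ^+ n < k%:R.
  by apply: truncn_itv; rewrite mulr_ge0// ltW.
have kr : k%:R / 2 ^+ n < r.
  move: ka; rewrite -ler_pdivrMr// /k /= -(natr1 (Num.truncn _)) mulrDl div1r; lra.
have kn : (k <= 2 ^ n)%N.
  rewrite -(ler_nat R) natrX -[leRHS]mul1r -ler_pdivrMr//.
  by apply: ltW; exact: lt_le_trans kr r1.
have subE m' : ev (mv_muln k (mvdyadic D n) ⊖ a) m' =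
    Num.max (k%:R / 2 ^+ n - ev a m') 0.
  by rewrite (uval_hom_minus (hat_mv_hom R m')) hat_muln_dyadic.
have mk : ~ m (mv_muln k (mvdyadic D n) ⊖ a).
  move=> /hat_eq0/eqP; rewrite subE eq_maxr subr_le0 leNgt.
  by rewrite ltr_pdivlMr ?ak.
have := open_nbhs_nbhs (conj (open_notin_max _) mk).
apply: filterS => m' /= m'k; apply: le_lt_trans kr; rewrite leNgt.
apply/negP => ka'; apply: m'k; apply/hat_eq0; rewrite subE.
by apply/eqP; rewrite eq_maxr subr_le0 ltW.
Qed.

(** Upper semicontinuity of [a] and of [¬ a] gives the two one-sided bounds. *)
Lemma hat_continuous a : continuous (hat R a).
Proof.
apply: unit_continuousP => m; apply/(@cvgrPdist_lt R R^o _ (nbhs m)) => e e0.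
have lt1 : ev a m < ev a m + e by rewrite ltrDl.
have lt2 : ev (¬ a) m < ev (¬ a) m + e by rewrite ltrDl.
apply: (@filterS2 _ (nbhs m) _ _ _ _ _ (near_hat_lt lt1) (near_hat_lt lt2)).
by move=> m' /=; rewrite !(uval_homN (hat_mv_hom R _)) ltr_norml; lra.
Qed.

(** The sets [f <= s] and [f >= t] are hulls of ideals [I] and [J] with [i ⊕ j = 1]. The element [i]
    vanishes on the first set, and equals [1] on the second because [j] vanishes there. *)
Lemma hat_urysohn (f : mvC R (Max D)) s t : s < t ->
  exists a, forall m, (uval (f m) <= s -> ev a m = 0) /\
                      (t <= uval (f m) -> ev a m = 1).
Proof.
move=> st.
have fc : continuous (@uval R \o f : Max D -> R).
  by move=> m; apply: continuous_comp; [exact: cts_fun|exact: uval_continuous].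
have /max_closedP[I FI] : closed [set m | uval (f m) <= s].
  exact: (@preimage_closed _ _ (@uval R \o f : Max D -> R) _
    (fun m _ => fc m) (@closed_le R s)).
have /max_closedP[J FJ] : closed [set m | t <= uval (f m)].
  exact: (@preimage_closed _ _ (@uval R \o f : Max D -> R) _
    (fun m _ => fc m) (@closed_ge R t)).
have [|i [j [Ii Jj ij]]] := @hull_disjoint D I J.
  rewrite -FI -FJ; apply/seteqP; split=> // m [/= fs ft].
  by have := lt_le_trans st (le_trans ft fs); rewrite ltxx.
exists i => m; have hm := hat_mv_hom R m; split=> [fs|ft].
  have Im : hull I m by rewrite -FI.
  by apply/hat_eq0; exact: Im.
have j0 : ev j m = 0.
  have Jm : hull J m by rewrite -FJ.
  by apply/hat_eq0; exact: Jm.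
have := uval_homD hm i j; rewrite ij (uval_hom1 hm) j0 addr0 minEle.
by case: ifPn => //; case/andP: (uval_itv (hat R i m)) => _ ->.
Qed.

(* [p.1] is the average of functions separating [f <= 1/4] from [f >= 1/2] and
   [f <= 1/2] from [f >= 3/4]; hence it lies between [2 f - 1] and [2 f]. *)
Lemma hat_greedy (f : mvC R (Max D)) : exists p : D * mvC R (Max D),
  forall m, uval (f m) = (ev p.1 m + uval (p.2 m)) / 2.
Proof.
have [|u uf] := @hat_urysohn f (1/4) (1/2); first by lra.
have [|v vf] := @hat_urysohn f (1/2) (3/4); first by lra.
have aE m : ev (mvhalf u ⊕ mvhalf v) m = (ev u m + ev v m) / 2.
  rewrite (uval_homD (hat_mv_hom R m)) !hat_half -mulrDl min_l//.
  by have := uval_itv (hat R u m); have := uval_itv (hat R v m); lra.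
have g01 m : 0 <= 2 * uval (f m) - ev (mvhalf u ⊕ mvhalf v) m <= 1.
  rewrite aE; have [u0 u1] := uf m; have [v0 v1] := vf m.
  have := uval_itv (hat R u m); have := uval_itv (hat R v m).
  have := uval_itv (f m).
  have hu0 : ev u m = 0 \/ 1/4 < uval (f m) by case: leP => [/u0|]; [left|right].
  have hu1 : ev u m = 1 \/ uval (f m) < 1/2 by case: leP => [/u1|]; [left|right].
  have hv0 : ev v m = 0 \/ 1/2 < uval (f m) by case: leP => [/v0|]; [left|right].
  have hv1 : ev v m = 1 \/ uval (f m) < 3/4 by case: leP => [/v1|]; [left|right].
  by case: hu0; case: hu1; case: hv0; case: hv1; lra.
have gc : continuous (fun m => unit_mk (g01 m)).
  apply: unit_continuousP => m; have Fm : Filter (nbhs m) := nbhs_filter m.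
  have fc : (@uval R \o f) x @[x --> m] --> (uval (f m) : R).
    by apply: continuous_comp; [exact: cts_fun|exact: uval_continuous].
  have ac : ev (mvhalf u ⊕ mvhalf v) x @[x --> m] --> ev (mvhalf u ⊕ mvhalf v) m.
    by apply: continuous_comp; [exact: hat_continuous|exact: uval_continuous].
  exact: (@cvgB R R^o _ _ _ _ _ _ _ (@cvgM R _ _ _ _ _ _ _ (cvg_cst (2 : R)) fc) ac).
exists (mvhalf u ⊕ mvhalf v, (mkcts gc : continuousType (Max D) (unit_interval R))).
move=> m /=; set x := ev _ m.
have -> : uval (mvC_fun (mkcts gc : continuousType (Max D) (unit_interval R)) m) =
  2 * uval (f m) - x by [].
by lra.
Qed.

Lemma hat_surj (f : mvC R (Max D)) : exists a, hat R a =1 f.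
Proof.
have [F FE] := choice hat_greedy.
pose fs n := iter n (fun g => (F g).2) f.
pose s n := (F (fs n)).1.
exists (delta s) => m; apply: uval_inj.
(* Both sequences satisfy [v k = (s k + v (k+1)) / 2], so the error at [k] is half the error at
   [k + 1]; the induction on [n] therefore needs all [k] at once. *)
suff close n k : `|uval (fs k m) - ev (delta (fun i => s (k + i)%N)) m| <=
    2 / 2 ^+ n.
  apply/eqP; rewrite eq_sym -subr_eq0 -normr_le0.
  by apply: le_half_pow => n; rewrite add0r; exact: (close n 0%N).
elim: n k => [|n ih] k.
  rewrite expr0 divr1 ler_norml.
  have := uval_itv (fs k m); have := uval_itv (hat R (delta (fun i => s (k + i)%N)) m).
  by lra.
rewrite hat_delta FE addn0 -/(s k) -[(F (fs k)).2]/(fs k.+1).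
have -> : (fun i => s (k + i.+1)%N) = (fun i => s (k.+1 + i)%N).
  by apply/funext => i; rewrite addnS.
have := ih k.+1; rewrite !ler_norml exprS invfM.
move: (uval (hat _ (delta _) _)) (uval (fs k.+1 m)) (2 ^+ n)^-1 (ev (s k) m).
by move=> *; lra.
Qed.

End HatDelta.

Lemma delta_hat_iso (R : realType) (D : deltaAlgType) :
  exists eta : D -> mvC R (Max D),
    (forall a m, eta a m = hat R a m) /\ mv_iso eta.
Proof.
pose eta (a : D) : mvC R (Max D) :=
  (mkcts (@hat_continuous R D a) : continuousType (Max D) (unit_interval R)).
have etaE a m : eta a m = hat R a m by [].
exists eta; split=> //; split.
  split=> [|a|a b]; apply: mvC_ext => m; rewrite etaE;
    by have [h0 hN hD] := hat_mv_hom R m; rewrite ?h0 ?hN ?hD.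
have /choice[g gE] : forall f : mvC R (Max D), exists a, eta a = f.
  by move=> f; have [a af] := hat_surj f; exists a; apply: mvC_ext => m; exact: af.
exists g => [a|//]; apply: (@hat_inj R) => m.
by rewrite -etaE gE.
Qed.

(** * Binary-weighted sums of sequences in the unit interval *)

Section BinarySum.
Local Open Scope ring_scope.
Variable R : realType.
Implicit Types x y : nat -> R.

Definition in01 x := forall n, 0 <= x n <= 1.

(** The exponent [n.+1] accounts for indices starting at [0]: the weights [1/2, 1/4, ...] add up to
    [1]. *)
Definition bsum x : R := limn (series (fun n => x n / 2 ^+ n.+1)).

Lemma is_cvg_bsum x : in01 x -> cvgn (series (fun n => x n / 2 ^+ n.+1)).
Proof.
move=> x01; apply: (@series_le_cvg _ _ (geometric (1 / 2) (1 / 2))) => [n|n|n|].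
- by have /andP[? ?] := x01 n; rewrite divr_ge0// exprn_ge0.
- by rewrite geometric_ge0//; lra.
- rewrite /= div1r exprVn -invfM -exprS ler_piMl ?invr_ge0 ?exprn_ge0//.
  by have /andP[] := x01 n.
- by apply: is_cvg_geometric_series; rewrite ger0_norm; lra.
Qed.

(** Real counterpart of [hat_delta], obtained as the limit of the partial sums with their first term
    split off. *)
Lemma bsumS x : in01 x -> bsum x = (x 0%N + bsum (fun n => x n.+1)) / 2.
Proof.
move=> x01; have y01 : in01 (fun n => x n.+1) by move=> n; exact: x01.
apply/cvg_lim => //; rewrite -(cvg_shiftS _); rewrite /=.
have -> : (fun n => series (fun n => x n / 2 ^+ n.+1) n.+1) =
    (fun n => (x 0%N + series (fun n => x n.+1 / 2 ^+ n.+1) n) / 2).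
  apply/funext => n; rewrite /series /= big_nat_recl// mulrDl expr1.
  rewrite big_distrl/=; congr (_ + _); apply: eq_bigr => i _.
  by rewrite [in LHS]exprS invfM mulrCA mulrC.
apply: (@cvgM R); last exact: cvg_cst.
by apply: (@cvgD _ R^o); [exact: cvg_cst|exact: is_cvg_bsum].
Qed.

Lemma bsum_le x y : in01 x -> in01 y -> (forall n, x n <= y n) ->
  bsum x <= bsum y.
Proof.
move=> x01 y01 xy; apply: lim_series_le; [exact: is_cvg_bsum..|] => n.
by rewrite ler_pM2r// invr_gt0 exprn_gt0.
Qed.

Lemma bsum_cst (c : R) : 0 <= c <= 1 -> bsum (fun=> c) = c.
Proof. by move=> c01; have := @bsumS (fun=> c) (fun=> c01); lra. Qed.

Lemma bsum_itv x : in01 x -> 0 <= bsum x <= 1.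
Proof.
move=> x01; have c01 (c : R) : 0 <= c <= 1 -> in01 (fun=> c) by move=> ? n.
have z01 : 0 <= (0 : R) <= 1 by lra.
have o01 : 0 <= (1 : R) <= 1 by lra.
apply/andP; split.
  rewrite -(bsum_cst z01); apply: bsum_le; [exact: c01|exact: x01|].
  by move=> n; case/andP: (x01 n).
rewrite -[leRHS](bsum_cst o01); apply: bsum_le; [exact: x01|exact: c01|].
by move=> n; case/andP: (x01 n).
Qed.

Lemma bsum_half x : in01 x -> bsum (fun n => x n / 2) = bsum x / 2.
Proof.
move=> x01; rewrite /bsum [RHS]mulrC.
rewrite -[RHS](@lim_seriesZ R _ 2^-1 (is_cvg_bsum x01)).
congr (limn (series _)); apply/funext => n /=.
by rewrite [RHS]mulrC mulrAC.
Qed.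

(** By [bsumS] the oscillation is at most half the sum of those of head and tail. The ratio [3/4]
    leaves room for the head: a tail within [q] and a head within [q/2] give [3q/4]. *)
Lemma bsum_continuous (X : topologicalType) (f : nat -> X -> R) :
  (forall n, continuous (f n : X -> R^o)) -> (forall n t, 0 <= f n t <= 1) ->
  continuous ((fun t => bsum (f ^~ t)) : X -> R^o).
Proof.
move=> fc f01 t; apply/cvgrPdist_lt => e e0.
(* The family [g] is quantified inside because the induction passes to the shifted family. *)
have near_le n : forall g : nat -> X -> R,
    (forall k, continuous (g k : X -> R^o)) -> (forall k t, 0 <= g k t <= 1) ->
    \forall u \near t, `|bsum (g ^~ t) - bsum (g ^~ u)| <= (3 / 4) ^+ n.
  elim: n => [|n ih] g gc g01.
    apply: filterE => u; rewrite expr0 ler_norml.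
    have := @bsum_itv (g ^~ t) (fun k => g01 k t).
    by have := @bsum_itv (g ^~ u) (fun k => g01 k u); lra.
  have p0 : 0 < (3 / 4 : R) ^+ n by rewrite exprn_gt0//; lra.
  near=> u.
  have : `|bsum (fun k => g k.+1 t) - bsum (fun k => g k.+1 u)| <= (3 / 4) ^+ n.
    by near: u; exact: (ih (fun k => g k.+1)).
  have : `|g 0%N t - g 0%N u| < (3 / 4) ^+ n / 2.
    near: u; have /cvgrPdist_lt := gc 0%N t; apply; lra.
  rewrite (@bsumS (g ^~ t))// (@bsumS (g ^~ u))// !ler_norml ltr_norml exprS.
  by lra.
have [n ne] : exists n, (3 / 4) ^+ n < e.
  have : geometric 1 (3 / 4 : R) @ \oo --> 0.
    by apply: cvg_geometric; rewrite ger0_norm; lra.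
  move=> /cvgrPdist_lt/(_ e e0)[n _ /(_ n (leqnn n))] /=.
  rewrite sub0r normrN mul1r ger0_norm; first by exists n.
  by rewrite exprn_ge0//; lra.
by apply: filterS (near_le n f fc f01) => u; move=> /le_lt_trans; apply.
Unshelve. all: by end_near. Qed.

End BinarySum.

(** * Transport of the binary sum to a delta-algebra structure *)

(** Destructing [A] exposes its carrier and class; packing the new axioms on these makes the reduct
    convertible to [A]. *)
Lemma delta_reduct (A : mvAlgType) (dlt : (nat -> A) -> A) :
  (forall x, mvdist (dlt x) (dlt (scons (x 0%N) (fun=> mv0))) =
             dlt (scons mv0 (fun n => x n.+1))) ->
  (forall x, half_of dlt (dlt x) = dlt (fun n => half_of dlt (x n))) ->
  (forall x, dlt (fun=> x) = x) ->
  (forall x, dlt (scons mv0 x) = half_of dlt (dlt x)) ->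
  (forall x y, dlt x ≼ dlt (fun n => x n ⊕ y n)) ->
  (forall x y, half_of dlt (x ⊖ y) = half_of dlt x ⊖ half_of dlt y) ->
  exists D : deltaAlgType, (D : mvAlgType) = A.
Proof.
case: A dlt => T c dlt A1 A2 A3 A4 A5 A6.
pose mixin := @MVAlgebra_isDelta.Axioms_ T _ _ _ dlt A1 A2 A3 A4 A5 A6.
by exists (DeltaAlgebra.Pack (DeltaAlgebra.Class mixin)).
Qed.

Section DeltaOfIso.
Local Open Scope ring_scope.
Variables (R : realType) (X : topologicalType) (A : mvAlgType).
Variable eta : A -> mvC R X.
Hypothesis eta_iso : mv_iso eta.
Implicit Types (a b : A) (s : nat -> A).

Local Notation ev a t := (uval (eta a t)).

(** The pointwise binary sum is continuous, so it is an element of [mvC R X] and is pulled back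
    along the inverse of [eta]. *)
Lemma iso_bsum s : exists a, forall t, ev a t = bsum (fun n => ev (s n) t).
Proof.
have [_ [g _ etaK]] := eta_iso.
have b01 t : 0 <= bsum (fun n => ev (s n) t) <= 1.
  by apply: bsum_itv => n; exact: uval_itv.
have bc : continuous (fun t => unit_mk (b01 t)).
  apply: unit_continuousP; apply: bsum_continuous => n t; last exact: uval_itv.
  by apply: continuous_comp; [exact: cts_fun|exact: uval_continuous].
by exists (g (mkcts bc : continuousType X (unit_interval R))) => t; rewrite etaK.
Qed.

Let dlt : (nat -> A) -> A := projT1 (choice iso_bsum).
Let dltE s t : ev (dlt s) t = bsum (fun n => ev (s n) t).
Proof. exact: (projT2 (choice iso_bsum) s t). Qed.

(** Reduces each delta axiom to a statement about reals at every point [t]. *)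
Let ev_inj a b : (forall t, ev a t = ev b t) -> a = b.
Proof.
have [_ /bij_inj ei] := eta_iso.
by move=> ab; apply: ei; apply: mvC_ext => t; apply: uval_inj; exact: ab.
Qed.

Let evh t : mv_hom (fun a => eta a t).
Proof. by have [[e0 eN eD] _] := eta_iso; split=> [|a|a b]; rewrite ?e0 ?eN ?eD. Qed.

Let ev01 s t : in01 (fun n => ev (s n) t).
Proof. by move=> n; exact: uval_itv. Qed.

Let dlt_scons a s t : ev (dlt (scons a s)) t = (ev a t + ev (dlt s) t) / 2.
Proof. by rewrite !dltE bsumS. Qed.

Let dlt_cst a : dlt (fun=> a) = a.
Proof. by apply: ev_inj => t; rewrite dltE bsum_cst// uval_itv. Qed.

Let dlt_half a t : ev (half_of dlt a) t = ev a t / 2.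
Proof. by rewrite dlt_scons dlt_cst (uval_hom0 (evh t)) addr0. Qed.

(** For head [a] and tail sum [b], pointwise this is [|(a + b)/2 - a/2| = b/2], where [b >= 0]. *)
Let dltA1 s : mvdist (dlt s) (dlt (scons (s 0%N) (fun=> mv0))) =
  dlt (scons mv0 (fun n => s n.+1)).
Proof.
apply: ev_inj => t; rewrite /mvdist (uval_homD (evh t)) !(uval_hom_minus (evh t)).
rewrite !dlt_scons dlt_cst (uval_hom0 (evh t)) dltE bsumS// -dltE.
have := uval_itv (eta (dlt (fun n => s n.+1)) t); have := uval_itv (eta (s 0%N) t).
by rewrite !maxEle minEle; do ![case: ifPn; rewrite -?ltNge]; lra.
Qed.

Let dltA2 s : half_of dlt (dlt s) = dlt (fun n => half_of dlt (s n)).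
Proof.
apply: ev_inj => t; rewrite dlt_half !dltE -bsum_half//; congr bsum.
by apply/funext => n; rewrite dlt_half.
Qed.

Let dltA4 s : dlt (scons mv0 s) = half_of dlt (dlt s).
Proof.
by apply: ev_inj => t; rewrite dlt_scons dlt_half (uval_hom0 (evh t)) add0r.
Qed.

Let dltA5 r s : dlt r ≼ dlt (fun n => r n ⊕ s n).
Proof.
apply: ev_inj => t; rewrite (uval_hom_minus (evh t)) (uval_hom0 (evh t)).
apply/eqP; rewrite eq_maxr subr_le0 !dltE; apply: bsum_le => // n.
by apply: (uval_hom_le (evh t)); exact: mvle_plusr.
Qed.

Let dltA6 a b : half_of dlt (a ⊖ b) = half_of dlt a ⊖ half_of dlt b.
Proof.
apply: ev_inj => t; rewrite (uval_hom_minus (evh t)) !dlt_half.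
rewrite (uval_hom_minus (evh t)) !maxEle.
by do ![case: ifPn; rewrite -?ltNge]; lra.
Qed.

Lemma delta_of_iso : exists D : deltaAlgType, (D : mvAlgType) = A.
Proof. exact: (delta_reduct dltA1 dltA2 dlt_cst dltA4 dltA5 dltA6). Qed.

End DeltaOfIso.

Theorem theorem8p1 (R : realType) (A : mvAlgType) :
  (exists D : deltaAlgType, (D : mvAlgType) = A) <->
  (exists eta : A -> mvC R (Max A),
      (forall (a : A) (m : Max A), eta a m = hat R a m) /\ mv_iso eta).
Proof.
split=> [[D <-]|[eta [_ eta_iso]]]; first exact: delta_hat_iso.
exact: delta_of_iso eta_iso.
Qed.
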